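(* The function \[ F_0(k,a,b,c,d,e) = (-1)^{a+b+c+d+e}(e+2k)\,\frac{\Gamma(a+k)\Gamma(b+k)\Gamma(c+k)\Gamma(d+k)}{\Gamma(e-a+1+k)\Gamma(e-b+1+k)\Gamma(e-c+1+k)\Gamma(e-d+1+k)} \] \[ \times\frac{\Gamma(a+b+c+d-2e)}{\Gamma(a+b-e)\Gamma(a+c-e)\Gamma(a+d-e)\Gamma(b+c-e)\Gamma(b+d-e)\Gamma(c+d-e)} \] is a WZ seed in the variables $a,b,c,d,e$.
   Context: A term $F(n_1,\dots,n_r)$ is hypergeometric in $n_1,\dots,n_r$ if each ratio $F(\dots,n_i+1,\dots)/F(\dots,n_i,\dots)$ is a rational function of $n_1,\dots,n_r$. Write $\Delta_n f(n)=f(n+1)-f(n)$. Two hypergeometric terms $F(n,k),G(n,k)$ form a WZ pair, and $G$ is called a WZ mate of $F$, if $\Delta_n F(n,k)=\Delta_k G(n,k)$. A hypergeometric term $F_0(k,a,b,\dots)$ (hypergeometric in $k,a,b,\dots$) is a WZ seed in the variables $a,b,\dots$ if for all integers $K,A,B,\dots$ and all complex $k_0$ and all values of the parameters $a,b,\dots$, the term $F(n,k)=F_0(Kn+k_0+k,\,An+a,\,Bn+b,\dots)$ has a WZ mate $G(n,k)$ (a hypergeometric term). Factors such as $(-1)^x$ or $z^x$ with non-integer exponent $x$ are understood as hypergeometric factors satisfying $(-1)^{x+1}=-(-1)^x$, $z^{x+1}=z\cdot z^x$ (e.g. defined via a fixed branch of the exponential). *)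

(* Defs.v *)
From HB Require Import structures.
From mathcomp Require Import all_boot all_order all_algebra.
Set Implicit Arguments.
Unset Strict Implicit.
Unset Printing Implicit Defensive.
Import Order.TTheory GRing.Theory Num.Theory.
Local Open Scope ring_scope.

Section HyperModel.
Variable C : numClosedFieldType.

(* Bivariate polynomials in (n,k): outer variable = k, inner variable = n. *)
Definition P2 := {poly {poly C}}.
Definition RF := {fraction P2}.
Definition rf (p : P2) : RF := FracField.tofrac p.

Definition var_n : P2 := ('X)%:P.
Definition var_k : P2 := 'X.
Definition cst (c : C) : P2 := c%:P%:P.

Definition shift_n (p : P2) : P2 := map_poly (fun q : {poly C} => q \Po ('X + 1)) p.
Definition shift_k (p : P2) : P2 := p \Po ('X + 1).

Record linform := Lin { lin_n : int; lin_k : int; lin_c : C }.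
Definition linP (L : linform) : P2 :=
  var_n *~ lin_n L + var_k *~ lin_k L + cst (lin_c L).
Definition addL (L M : linform) := Lin (lin_n L + lin_n M) (lin_k L + lin_k M) (lin_c L + lin_c M).
Definition subL (L M : linform) := Lin (lin_n L - lin_n M) (lin_k L - lin_k M) (lin_c L - lin_c M).
Definition scaleL (z : int) (L : linform) := Lin (z * lin_n L) (z * lin_k L) (lin_c L *~ z).
Definition cstL (c : C) := Lin 0 0 c.
Definition shiftL_n (L : linform) := Lin (lin_n L) (lin_k L) (lin_c L + (lin_n L)%:~R).
Definition shiftL_k (L : linform) := Lin (lin_n L) (lin_k L) (lin_c L + (lin_k L)%:~R).

(* Gamma(x + m) / Gamma(x) as a rational function, x a polynomial, m : int. *)
Definition gamma_shift (x : P2) (m : int) : RF :=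
  match m with
  | Posz j => \prod_(i < j) rf (x + i%:R)
  | Negz j => (\prod_(i < j.+1) rf (x - i.+1%:R))^-1
  end.

(* A closed-form term
     (-1)^(sgn) * prod_{L in lins} L * prod_{L in nums} Gamma(L) / prod_{L in dens} Gamma(L)
   in the variables (n,k). *)
Record cterm := CTerm {
  ct_sign : linform; ct_lin : seq linform; ct_num : seq linform; ct_den : seq linform }.

(* The shift quotients F(n+1,k)/F(n,k) and F(n,k+1)/F(n,k), computed from the
   functional equations (-1)^(x+1) = -(-1)^x and Gamma(x+1) = x Gamma(x). *)
Definition ratio_n (T : cterm) : RF :=
  (-1) ^ lin_n (ct_sign T)
  * \prod_(L <- ct_lin T) (rf (linP (shiftL_n L)) / rf (linP L))
  * \prod_(L <- ct_num T) gamma_shift (linP L) (lin_n L)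
  / \prod_(L <- ct_den T) gamma_shift (linP L) (lin_n L).
Definition ratio_k (T : cterm) : RF :=
  (-1) ^ lin_k (ct_sign T)
  * \prod_(L <- ct_lin T) (rf (linP (shiftL_k L)) / rf (linP L))
  * \prod_(L <- ct_num T) gamma_shift (linP L) (lin_k L)
  / \prod_(L <- ct_den T) gamma_shift (linP L) (lin_k L).

(* Hypergeometric terms similar to F are G = R * F with R = p/q rational;
   in this module  Delta_n F = (ratio_n F - 1) F  and
   Delta_k (R F) = (shift_k(R) * ratio_k F - R) F.
   G = (p/q) F is a WZ mate of F iff these coefficients agree. *)
Definition is_WZ_mate (F : cterm) (p q : P2) : Prop :=
  q != 0 /\
  ratio_n F - 1 = rf (shift_k p) / rf (shift_k q) * ratio_k F - rf p / rf q.
Definition has_WZ_mate (F : cterm) : Prop := exists p q : P2, is_WZ_mate F p q.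

Definition F0_term (k a b c d e : linform) : cterm :=
  CTerm
    (addL (addL (addL (addL a b) c) d) e)
    [:: addL e (scaleL 2 k)]
    [:: addL a k; addL b k; addL c k; addL d k;
        subL (addL (addL (addL a b) c) d) (scaleL 2 e)]
    [:: addL (addL (subL e a) (cstL 1)) k; addL (addL (subL e b) (cstL 1)) k;
        addL (addL (subL e c) (cstL 1)) k; addL (addL (subL e d) (cstL 1)) k;
        subL (addL a b) e; subL (addL a c) e; subL (addL a d) e;
        subL (addL b c) e; subL (addL b d) e; subL (addL c d) e].

Definition F0_subst (K A B Cc D E : int) (k0 a b c d e : C) : cterm :=
  F0_term (Lin K 1 k0) (Lin A 0 a) (Lin B 0 b) (Lin Cc 0 c) (Lin D 0 d) (Lin E 0 e).

End HyperModel.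

(* Main.v *)
(* Put alpha = a - e/2, ..., delta = d - e/2, kappa = k + e/2.  Up to sign, F0 is the product of
   2 kappa prod Gamma(kappa + alpha)/Gamma(kappa - alpha + 1), which depends on k, and of
   Gamma(s)/prod Gamma(x_ij), which does not, where s = a+b+c+d-2e and x_ab = a+b-e, etc.
   Call two integer translates of F0 cohomologous if they differ by Delta_k (R F0) with R rational;
   this is an equivalence relation, so it is enough to go from F0(y) to F0(y + v) in small steps,
   where y = (k,a,b,c,d,e).  The steps come from identities in the style of Gosper's algorithm:
   adding 1 to k, to a, to (b,c,d,e), to (a,b,e), and the images of these under permutations of
   a,b,c,d.

   A form x_ij or s that does not involve n may be an integer constant, and then a generic mate can
   have a pole; this is avoided by never moving such a form.  The step (b,c,d,e) moves only s, x_bc,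
   x_bd, x_cd, the step a only s, x_ab, x_ac, x_ad, and the step (a,b,e) only x_ab, x_cd.  Let S and
   X_ij be the increments of s and x_ij, so X_ab + X_cd = X_ac + X_bd = X_ad + X_bc = S.  If S <> 0,
   each of the three pairs contains a form that moves, and exactly one of the eight steps of the
   first two kinds moves s and the chosen forms only; S such steps reduce to S = 0.  Then the steps
   (a,b,e), (a,c,e), (a,d,e) bring all X_ij to 0, after which only kappa is left to move. *)
Require Import Defs.
From HB Require Import structures.
From mathcomp Require Import all_boot all_order all_algebra.
From mathcomp Require Import ring zify.
Set Implicit Arguments.
Unset Strict Implicit.
Unset Printing Implicit Defensive.
Import Order.TTheory GRing.Theory Num.Theory.
Local Open Scope ring_scope.

(** * Quotients Gamma(x + m) / Gamma(x) over an arbitrary field *)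

Section GammaShift.
Variable K : fieldType.

(** Makes every factor of [gshift x m] nonzero, for all [m] of either sign. *)
Definition nonint (x : K) : Prop := forall j : int, x + j%:~R != 0.

Definition gshift (x : K) (m : int) : K :=
  match m with
  | Posz j => \prod_(i < j) (x + i%:R)
  | Negz j => (\prod_(i < j.+1) (x - i.+1%:R))^-1
  end.

Lemma gshift0 x : gshift x 0 = 1.
Proof. exact: big_ord0. Qed.

Lemma gshift1 x : gshift x 1 = x.
Proof. by rewrite -[LHS]/(\prod_(i < 1) (x + i%:R)) big_ord1 addr0. Qed.

Lemma gshiftS x m : nonint x -> gshift x (m + 1) = gshift x m * (x + m%:~R).
Proof.
move=> nx; case: m => [j|[|j]].
- by rewrite -PoszD addn1 /gshift big_ord_recr.
- by rewrite [LHS]gshift0 /gshift big_ord1 mulVf // (nx (- 1)).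
- have -> : Negz j.+1 + 1 = Negz j by rewrite !NegzE; lia.
  (* The last factor of the inverted product is x + m itself, so it cancels. *)
  rewrite /gshift [in RHS]big_ord_recr /= invfM -mulrA [X in _ = _ * X]mulVf ?mulr1 //.
  exact: (nx (Negz j.+1)).
Qed.

(* The hypothesis [nonint z] only serves to fix the form of z when rewriting. *)
Lemma gshift_up x m m' z :
  nonint z -> nonint x -> m' = m + 1 -> z = x + m%:~R -> gshift x m' = gshift x m * z.
Proof. by move=> _ nx -> ->; exact: gshiftS. Qed.

Lemma gshift_down x m m' z :
  nonint z -> nonint x -> m = m' + 1 -> z = x + m'%:~R -> gshift x m' = gshift x m / z.
Proof. by move=> _ nx -> ->; rewrite gshiftS // mulfK. Qed.

Variable s : {rmorphism K -> K}.

Lemma rmorph_gshift x m : s (gshift x m) = gshift (s x) m.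
Proof.
case: m => j; rewrite /gshift ?fmorphV rmorph_prod; last congr (_^-1);
  by apply: eq_bigr => i _; rewrite ?rmorphB ?rmorphD rmorph_nat.
Qed.

(** Both sides stand for Gamma(x + m + 1) / Gamma(x). *)
Lemma gshift_add1 x m : nonint x -> gshift (x + 1) m * x = gshift x m * (x + m%:~R).
Proof.
move=> nx; have nx1 : nonint (x + 1).
  by move=> j; have := nx (1 + j); rewrite intrD addrA.
elim/int_ind: m => [|n IH|n IH].
- by rewrite !gshift0 addr0.
- by rewrite -addn1 PoszD !gshiftS // mulrAC IH; ring.
- have E : - n%:Z = - n.+1%:Z + 1 by lia.
  move: IH; rewrite E !gshiftS // intrD => IH.
  have nz : x + 1 + (- n.+1%:Z)%:~R != 0 by exact: nx1.
  apply: (mulIf nz); rewrite mulrAC IH; ring.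
Qed.

Lemma rmorph_gshift_add1 x m z : nonint x -> s x = x + 1 -> z = x + m%:~R ->
  s (gshift x m) = gshift x m * (z / x).
Proof.
move=> nx sx ->; have x0 : x != 0 by have := nx 0; rewrite addr0.
by rewrite rmorph_gshift sx mulrA -gshift_add1 // mulfK.
Qed.

End GammaShift.

(** * Translates of F0, their cohomology relation and its symmetries *)

Record vec (T : Type) := Vec { vk : T; va : T; vb : T; vc : T; vd : T; ve : T }.

(** These adjacent transpositions generate all permutations of a, b, c, d, so each type of step has
    to be computed only once. *)
Definition swap_ab T (v : vec T) := let: Vec k a b c d e := v in Vec k b a c d e.
Definition swap_bc T (v : vec T) := let: Vec k a b c d e := v in Vec k a c b d e.
Definition swap_cd T (v : vec T) := let: Vec k a b c d e := v in Vec k a b d c e.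

Section Seed.
Variables (K : fieldType) (s : {rmorphism K -> K}).

Definition translate (y : vec K) (v : vec int) : vec K :=
  Vec (vk y + (vk v)%:~R) (va y + (va v)%:~R) (vb y + (vb v)%:~R)
      (vc y + (vc v)%:~R) (vd y + (vd v)%:~R) (ve y + (ve v)%:~R).

(* The quotient F0(y + v) / F0(y), computed from the functional equations only, hence meaningful
   even when the arguments of some constant Gamma factors of F0(y) are poles of Gamma. *)
Definition quotient (y : vec K) (v : vec int) : K :=
  let: Vec k a b c d e := y in let: Vec k' a' b' c' d' e' := v in
  (-1) ^ (a' + b' + c' + d' + e') * ((e + e'%:~R + 2 * (k + k'%:~R)) / (e + 2 * k))
  * (gshift (a + k) (a' + k') * gshift (b + k) (b' + k')
     * gshift (c + k) (c' + k') * gshift (d + k) (d' + k')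
     * gshift (a + b + c + d - 2 * e) (a' + b' + c' + d' - 2 * e'))
  / (gshift (e - a + 1 + k) (e' - a' + k') * gshift (e - b + 1 + k) (e' - b' + k')
     * gshift (e - c + 1 + k) (e' - c' + k') * gshift (e - d + 1 + k) (e' - d' + k')
     * (gshift (a + b - e) (a' + b' - e') * gshift (a + c - e) (a' + c' - e')
        * gshift (a + d - e) (a' + d' - e') * gshift (b + c - e) (b' + c' - e')
        * gshift (b + d - e) (b' + d' - e') * gshift (c + d - e) (c' + d' - e'))).

(** This is F0(k + 1) / F0(k); the Gamma factors free of k have cancelled. *)
Definition kquotient (y : vec K) : K :=
  let: Vec k a b c d e := y in
  (e + 2 * k + 2) / (e + 2 * k) * ((a + k) * (b + k) * (c + k) * (d + k))
  / ((e - a + 1 + k) * (e - b + 1 + k) * (e - c + 1 + k) * (e - d + 1 + k)).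

(* s is the shift k -> k + 1, and every factor of F0 depending on k is free of zeros and poles
   at all integer translates of y. *)
Definition summation_point (y : vec K) : Prop :=
  let: Vec k a b c d e := y in
  [/\ [/\ s k = k + 1, s a = a, s b = b & [/\ s c = c, s d = d & s e = e]],
      nonint (e + 2 * k),
      [/\ nonint (a + k), nonint (b + k), nonint (c + k) & nonint (d + k)]
    & [/\ nonint (e - a + 1 + k), nonint (e - b + 1 + k),
          nonint (e - c + 1 + k) & nonint (e - d + 1 + k)]].

(* Division by F0(y) of the equation F0(y + w) - F0(y + v) = Delta_k (R F0(y)). *)
Definition cohomologous (y : vec K) (v w : vec int) : Prop :=
  exists R, quotient y w - quotient y v = s R * kquotient y - R.

Lemma cohomologous_refl y v : cohomologous y v v.
Proof. by exists 0; rewrite rmorph0 mul0r !subrr. Qed.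

Lemma cohomologous_sym y v w : cohomologous y v w -> cohomologous y w v.
Proof.
by case=> R E; exists (- R); rewrite rmorphN mulNr -opprD -E opprB.
Qed.

Lemma cohomologous_trans y u v w :
  cohomologous y u v -> cohomologous y v w -> cohomologous y u w.
Proof.
move=> [R E] [R' E']; exists (R + R'); rewrite rmorphD mulrDl.
by rewrite opprD addrACA -E -E' addrC addrA subrK.
Qed.

(** Symmetry of the relation reverses a step, which gives the negative [m]. *)
Lemma cohomologous_iter y (f : int -> vec int) :
  (forall m, cohomologous y (f m) (f (m + 1))) ->
  forall m, cohomologous y (f 0) (f m).
Proof.
move=> step; elim/int_ind => [|n IH|n IH].
- exact: cohomologous_refl.
- by apply: cohomologous_trans IH _; rewrite -addn1 PoszD.
- apply: cohomologous_trans IH _; apply: cohomologous_sym.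
  by have := step (- n.+1%:Z); congr (cohomologous _ _ (f _)); lia.
Qed.

Lemma quotient_swap_ab y v : quotient (swap_ab y) (swap_ab v) = quotient y v.
Proof.
case: y v => k a b c d e [k' a' b' c' d' e']; rewrite /quotient /=.
(* [ring] treats each [gshift] as an atom, so the exchanged sums in its arguments are first brought
   to a common form. *)
rewrite !(addrC b a) !(addrC b' a') !invfM; ring.
Qed.

Lemma quotient_swap_bc y v : quotient (swap_bc y) (swap_bc v) = quotient y v.
Proof.
case: y v => k a b c d e [k' a' b' c' d' e']; rewrite /quotient /=.
rewrite !(addrAC a c b) !(addrAC a' c' b') !(addrC c b) !(addrC c' b') !invfM; ring.
Qed.

Lemma quotient_swap_cd y v : quotient (swap_cd y) (swap_cd v) = quotient y v.
Proof.
case: y v => k a b c d e [k' a' b' c' d' e']; rewrite /quotient /=.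
rewrite !(addrAC (a + b) d c) !(addrAC (a' + b') d' c') !(addrC d c) !(addrC d' c') !invfM; ring.
Qed.

Lemma summation_point_swap_ab y : summation_point y -> summation_point (swap_ab y).
Proof. by case: y => k a b c d e [[? ? ? [? ? ?]] ? [? ? ? ?] [? ? ? ?]]. Qed.

Lemma summation_point_swap_bc y : summation_point y -> summation_point (swap_bc y).
Proof. by case: y => k a b c d e [[? ? ? [? ? ?]] ? [? ? ? ?] [? ? ? ?]]. Qed.

Lemma summation_point_swap_cd y : summation_point y -> summation_point (swap_cd y).
Proof. by case: y => k a b c d e [[? ? ? [? ? ?]] ? [? ? ? ?] [? ? ? ?]]. Qed.

(** The same [R] serves, since [kquotient] is symmetric in a, b, c, d as well. *)
Lemma cohomologous_swap_ab y v w :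
  cohomologous (swap_ab y) (swap_ab v) (swap_ab w) -> cohomologous y v w.
Proof.
rewrite /cohomologous !quotient_swap_ab; case=> R E; exists R; rewrite E; congr (_ * _ - _).
by case: y {E} => k a b c d e /=; rewrite !invfM; ring.
Qed.

Lemma cohomologous_swap_bc y v w :
  cohomologous (swap_bc y) (swap_bc v) (swap_bc w) -> cohomologous y v w.
Proof.
rewrite /cohomologous !quotient_swap_bc; case=> R E; exists R; rewrite E; congr (_ * _ - _).
by case: y {E} => k a b c d e /=; rewrite !invfM; ring.
Qed.

Lemma cohomologous_swap_cd y v w :
  cohomologous (swap_cd y) (swap_cd v) (swap_cd w) -> cohomologous y v w.
Proof.
rewrite /cohomologous !quotient_swap_cd; case=> R E; exists R; rewrite E; congr (_ * _ - _).
by case: y {E} => k a b c d e /=; rewrite !invfM; ring.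
Qed.

Lemma nonint_neq0 (x : K) : nonint x -> x != 0.
Proof. by move=> /(_ 0); rewrite addr0. Qed.

Lemma nonint_addr (x z : K) (m : int) : nonint x -> z = x + m%:~R -> nonint z.
Proof. by move=> nx -> j; rewrite -addrA -intrD. Qed.

Lemma summation_point_translate y v :
  summation_point y -> summation_point (translate y v).
Proof.
case: y v => k a b c d e [k' a' b' c' d' e'] /=.
move=> [[sk sa sb [sc sd se]] nl [na nb nc nd] [ma mb mc md]].
split.
- by rewrite !rmorphD !rmorph_int sk sa sb sc sd se addrAC.
- by apply: (nonint_addr (m := (e' + 2 * k')) nl); ring.
- by split; [ apply: (nonint_addr (m := (a' + k')) na) | apply: (nonint_addr (m := (b' + k')) nb)
   | apply: (nonint_addr (m := (c' + k')) nc) | apply: (nonint_addr (m := (d' + k')) nd)]; ring.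
- by split; [ apply: (nonint_addr (m := (e' - a' + k')) ma)
   | apply: (nonint_addr (m := (e' - b' + k')) mb) | apply: (nonint_addr (m := (e' - c' + k')) mc)
   | apply: (nonint_addr (m := (e' - d' + k')) md)]; ring.
Qed.

(* The constant Gamma factors may vanish, so their inverses are generalized as atoms: [field]
   would otherwise require them to be nonzero. *)
Ltac generalize_gshift :=
  rewrite ?invfM ?invrK;
  repeat match goal with |- context [(gshift ?x ?m)^-1] => generalize (gshift x m)^-1 end;
  repeat match goal with |- context [gshift ?x ?m] => generalize (gshift x m) end.

Ltac generalize_neq0 :=
  repeat match goal with |- is_true (?x != 0) -> _ => generalize x; intros ? ? end.

(** With u the unit shift in k, both sides stand for F0(y + v + u) / F0(y), reached through y + u on
    the left and through y + v on the right. *)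
Lemma rmorph_quotient y v : summation_point y ->
  s (quotient y v) * kquotient y = quotient y v * kquotient (translate y v).
Proof.
move=> py; have := summation_point_translate v py; move: py.
case: y v => k a b c d e [k' a' b' c' d' e'] /=.
move=> [[sk sa sb [sc sd se]] nl [na nb nc nd] [ma mb mc md]].
move=> [_ nl' [na' nb' nc' nd'] [ma' mb' mc' md']].
have num x x' z : nonint z -> nonint (x + k) -> s x = x -> z = x + x'%:~R + (k + k'%:~R) ->
    s (gshift (x + k) (x' + k')) = gshift (x + k) (x' + k') * (z / (x + k)).
  move=> _ nx sx ->; apply: rmorph_gshift_add1 => //; first by rewrite rmorphD sx sk addrA.
  by ring.
have den x x' z : nonint z -> nonint (e - x + 1 + k) -> s x = x ->
      z = e + e'%:~R - (x + x'%:~R) + 1 + (k + k'%:~R) ->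
    s (gshift (e - x + 1 + k) (e' - x' + k')) =
      gshift (e - x + 1 + k) (e' - x' + k') * (z / (e - x + 1 + k)).
  move=> _ nx sx ->; apply: rmorph_gshift_add1 => //; last by ring.
  by rewrite !rmorphD rmorphN rmorph1 sx se sk addrA.
have l2 : e + 2 * k + 2 != 0 by exact: (nl 2).
have cst x m : s x = x -> s (gshift x m) = gshift x m by rewrite rmorph_gshift => ->.
have lin : s ((e + e'%:~R + 2 * (k + k'%:~R)) / (e + 2 * k)) =
    (e + e'%:~R + 2 * (k + k'%:~R) + 2) / (e + 2 * k + 2).
  rewrite fmorph_div !rmorphD !rmorphM !rmorphD !rmorph_int ?rmorph_nat se sk.
  by congr (_ / _); ring.
rewrite !(rmorphM _ (_ * _)) (rmorphM _ (_ ^ _)) lin !(rmorphM, fmorphV) fmorphXz rmorphN rmorph1.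
rewrite (num _ _ _ na' na sa erefl) (num _ _ _ nb' nb sb erefl).
rewrite (num _ _ _ nc' nc sc erefl) (num _ _ _ nd' nd sd erefl).
rewrite (den _ _ _ ma' ma sa erefl) (den _ _ _ mb' mb sb erefl).
rewrite (den _ _ _ mc' mc sc erefl) (den _ _ _ md' md sd erefl).
rewrite !cst ?(rmorphB, rmorphD) ?rmorphM ?rmorph_nat ?sa ?sb ?sc ?sd ?se //.
generalize_gshift.
move: (nonint_neq0 nl) l2 (nonint_neq0 nl').
move: (nonint_neq0 na) (nonint_neq0 nb) (nonint_neq0 nc) (nonint_neq0 nd).
move: (nonint_neq0 ma) (nonint_neq0 mb) (nonint_neq0 mc) (nonint_neq0 md).
move: (nonint_neq0 ma') (nonint_neq0 mb') (nonint_neq0 mc') (nonint_neq0 md').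
by generalize_neq0; move=> *; field; do ?[apply/andP; split].
Qed.

(** Moves the base point to y + v: [q] plays the role of F0(y + w) / F0(y + v), and [R] is a
    certificate relative to F0(y + v). Multiplying [R] by [quotient y v] makes it relative to
    F0(y). *)
Lemma cohomologous_step y v w q R : summation_point y ->
  quotient y w = quotient y v * q -> s R * kquotient (translate y v) - R = q - 1 ->
  cohomologous y v w.
Proof.
move=> py Eq ER; exists (quotient y v * R).
rewrite Eq rmorphM mulrAC rmorph_quotient // -[quotient y v in X in _ - X]mulr1 -mulrBr -ER; ring.
Qed.

Lemma exprN1S (m m' : int) : m' = m + 1 -> (-1) ^ m' = - (-1) ^ m :> K.
Proof. by move=> ->; rewrite exprzDr ?unitrN1 // expr1z mulrN1. Qed.

(** * The four elementary steps and their rational certificates *)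

Lemma cohomologous_step_k k0 a0 b0 c0 d0 e0 k a b c d e (y := Vec k0 a0 b0 c0 d0 e0) :
  summation_point y -> cohomologous y (Vec k a b c d e) (Vec (k + 1) a b c d e).
Proof.
move=> py; pose q := kquotient (translate y (Vec k a b c d e)).
(* F0(k + 1) - F0(k) is Delta_k F0 itself. *)
apply: (cohomologous_step (q := q) (R := 1)) => //; last by rewrite rmorph1 mul1r.
have := summation_point_translate (Vec k a b c d e) py; move: py; rewrite {}/q {}/y /=.
move=> [[sk sa sb [sc sd se]] nl [na nb nc nd] [ma mb mc md]].
move=> [_ nl' [na' nb' nc' nd'] [ma' mb' mc' md']].
rewrite (gshift_up (m := a + k) na' na); [|ring|ring].
rewrite (gshift_up (m := b + k) nb' nb); [|ring|ring].
rewrite (gshift_up (m := c + k) nc' nc); [|ring|ring].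
rewrite (gshift_up (m := d + k) nd' nd); [|ring|ring].
rewrite (gshift_up (m := e - a + k) ma' ma); [|ring|ring].
rewrite (gshift_up (m := e - b + k) mb' mb); [|ring|ring].
rewrite (gshift_up (m := e - c + k) mc' mc); [|ring|ring].
rewrite (gshift_up (m := e - d + k) md' md); [|ring|ring].
have -> : e0 + e%:~R + 2 * (k0 + (k + 1)%:~R) = e0 + e%:~R + 2 * (k0 + k%:~R) + 2 by ring.
generalize_gshift.
move: (nonint_neq0 ma') (nonint_neq0 mb') (nonint_neq0 mc') (nonint_neq0 md').
move: (nonint_neq0 nl) (nonint_neq0 nl').
by generalize_neq0; move=> *; field; do ?[apply/andP; split].
Qed.

(** The numerator of [R] at k + 1 cancels the denominator of [kquotient]. What remains, with xi
    running over alpha, beta, gamma, delta, is prod (kappa - xi) - prod (kappa + xi) = -2 kappa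
    ((kappa^2 - alpha^2) s + x_ab x_ac x_ad). *)
Lemma cohomologous_step_a k0 a0 b0 c0 d0 e0 k a b c d e (y := Vec k0 a0 b0 c0 d0 e0) :
  summation_point y ->
  nonint (a0 + b0 - e0) -> nonint (a0 + c0 - e0) -> nonint (a0 + d0 - e0) ->
  nonint (a0 + b0 + c0 + d0 - 2 * e0) ->
  cohomologous y (Vec k a b c d e) (Vec k (a + 1) b c d e).
Proof.
move=> py nab nac nad ns; have := summation_point_translate (Vec k a b c d e) py.
move E : (translate _ _) => y'; case: y' E => k' a' b' c' d' e' E py'.
pose R k' := - ((e' - a' + k') * (e' - b' + k') * (e' - c' + k') * (e' - d' + k'))
  / ((e' + 2 * k') * ((a' + b' - e') * (a' + c' - e') * (a' + d' - e'))).
pose q := - ((a' + k') * (e' - a' + k') * (a' + b' + c' + d' - 2 * e'))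
  / ((a' + b' - e') * (a' + c' - e') * (a' + d' - e')).
case: E py' => Ek Ea Eb Ec Ed Ee.
have nab' : nonint (a' + b' - e').
  by apply: (nonint_addr (m := a + b - e) nab); rewrite -Ea -Eb -Ee; ring.
have nac' : nonint (a' + c' - e').
  by apply: (nonint_addr (m := a + c - e) nac); rewrite -Ea -Ec -Ee; ring.
have nad' : nonint (a' + d' - e').
  by apply: (nonint_addr (m := a + d - e) nad); rewrite -Ea -Ed -Ee; ring.
have ns' : nonint (a' + b' + c' + d' - 2 * e').
  by apply: (nonint_addr (m := a + b + c + d - 2 * e) ns); rewrite -Ea -Eb -Ec -Ed -Ee; ring.
move=> [[sk sa sb [sc sd se]] nl' [na' nb' nc' nd'] [ma' mb' mc' md']].
(* Raising a lowers the argument e - a + 1 + k by one, which brings in this factor. *)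
have m0 : nonint (e' - a' + k') by apply: (nonint_addr (m := -1) ma'); ring.
apply: (@cohomologous_step y _ _ q (R k') py); last first.
  have -> : s (R k') = R (k' + 1).
    by rewrite /R !(rmorphM, fmorphV, rmorphN, rmorphD, rmorph_nat) sk sa sb sc sd se.
  rewrite /translate /y /= Ek Ea Eb Ec Ed Ee /R /q.
  move: (nonint_neq0 nl') (nl' 2) (nonint_neq0 ma') (nonint_neq0 mb') (nonint_neq0 mc').
  move: (nonint_neq0 md') (nonint_neq0 nab') (nonint_neq0 nac') (nonint_neq0 nad') => *.
  field; do ?[apply/andP; split] => //.
  by have -> : e' + 2 * (k' + 1) = e' + 2 * k' + 2 by ring.
move: py => [_ nl [na nb nc nd] [ma mb mc md]].
rewrite /= (gshift_up (m := a + k) na' na); [|ring|rewrite -Ea -Ek; ring].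
rewrite (gshift_up (m := a + b - e) nab' nab); [|ring|rewrite -Ea -Eb -Ee; ring].
rewrite (gshift_up (m := a + c - e) nac' nac); [|ring|rewrite -Ea -Ec -Ee; ring].
rewrite (gshift_up (m := a + d - e) nad' nad); [|ring|rewrite -Ea -Ed -Ee; ring].
rewrite (gshift_up (m := a + b + c + d - 2 * e) ns' ns);
  [|ring|rewrite -Ea -Eb -Ec -Ed -Ee; ring].
rewrite (gshift_down (m := e - a + k) m0 ma); [|ring|rewrite -Ea -Ee -Ek; ring].
rewrite (exprN1S (m := a + b + c + d + e)); last by ring.
rewrite /q; generalize_gshift.
move: (_ ^ _) (_ / (e0 + 2 * k0)) => sg l.
move: (nonint_neq0 m0) (nonint_neq0 nab') (nonint_neq0 nac') (nonint_neq0 nad').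
by generalize_neq0; move=> *; field; do ?[apply/andP; split].
Qed.

(** Put sigma = beta + gamma + delta, so that the last numerator factor of [R] is kappa + sigma.
    After division by kappa - alpha + 1 the identity becomes (kappa + sigma) prod (kappa - xi) -
    (kappa - sigma) prod (kappa + xi) = 2 kappa x_bc x_bd x_cd, with xi running over beta, gamma,
    delta. *)
Lemma cohomologous_step_bcde k0 a0 b0 c0 d0 e0 k a b c d e (y := Vec k0 a0 b0 c0 d0 e0) :
  summation_point y ->
  nonint (b0 + c0 - e0) -> nonint (b0 + d0 - e0) -> nonint (c0 + d0 - e0) ->
  nonint (a0 + b0 + c0 + d0 - 2 * e0) ->
  cohomologous y (Vec k a b c d e) (Vec k a (b + 1) (c + 1) (d + 1) (e + 1)).
Proof.
move=> py nbc nbd ncd ns; have := summation_point_translate (Vec k a b c d e) py.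
move E : (translate _ _) => y'; case: y' E => k' a' b' c' d' e' E py'.
pose R k' := (e' - b' + k') * (e' - c' + k') * (e' - d' + k') * (b' + c' + d' - e' + k')
  / ((e' + 2 * k') * ((b' + c' - e') * (b' + d' - e') * (c' + d' - e'))).
pose q := (e' + 1 + 2 * k')
  * ((b' + k') * (c' + k') * (d' + k') * (a' + b' + c' + d' - 2 * e'))
  / ((e' + 2 * k') * (e' - a' + 1 + k')
     * ((b' + c' - e') * (b' + d' - e') * (c' + d' - e'))).
case: E py' => Ek Ea Eb Ec Ed Ee.
have nbc' : nonint (b' + c' - e').
  by apply: (nonint_addr (m := b + c - e) nbc); rewrite -Eb -Ec -Ee; ring.
have nbd' : nonint (b' + d' - e').
  by apply: (nonint_addr (m := b + d - e) nbd); rewrite -Eb -Ed -Ee; ring.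
have ncd' : nonint (c' + d' - e').
  by apply: (nonint_addr (m := c + d - e) ncd); rewrite -Ec -Ed -Ee; ring.
have ns' : nonint (a' + b' + c' + d' - 2 * e').
  by apply: (nonint_addr (m := a + b + c + d - 2 * e) ns); rewrite -Ea -Eb -Ec -Ed -Ee; ring.
move=> [[sk sa sb [sc sd se]] nl' [na' nb' nc' nd'] [ma' mb' mc' md']].
apply: (@cohomologous_step y _ _ q (R k') py); last first.
  have -> : s (R k') = R (k' + 1).
    by rewrite /R !(rmorphM, fmorphV, rmorphN, rmorphD, rmorph_nat) sk sb sc sd se.
  rewrite /translate /y /= Ek Ea Eb Ec Ed Ee /R /q.
  move: (nonint_neq0 nl') (nl' 2) (nonint_neq0 ma') (nonint_neq0 mb') (nonint_neq0 mc').
  move: (nonint_neq0 md') (nonint_neq0 nbc') (nonint_neq0 nbd') (nonint_neq0 ncd') => *.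
  field; do ?[apply/andP; split] => //.
  by have -> : e' + 2 * (k' + 1) = e' + 2 * k' + 2 by ring.
move: py => [_ nl [na nb nc nd] [ma mb mc md]].
rewrite /= (gshift_up (m := b + k) nb' nb); [|ring|rewrite -Eb -Ek; ring].
rewrite (gshift_up (m := c + k) nc' nc); [|ring|rewrite -Ec -Ek; ring].
rewrite (gshift_up (m := d + k) nd' nd); [|ring|rewrite -Ed -Ek; ring].
rewrite (gshift_up (m := b + c - e) nbc' nbc); [|ring|rewrite -Eb -Ec -Ee; ring].
rewrite (gshift_up (m := b + d - e) nbd' nbd); [|ring|rewrite -Eb -Ed -Ee; ring].
rewrite (gshift_up (m := c + d - e) ncd' ncd); [|ring|rewrite -Ec -Ed -Ee; ring].
rewrite (gshift_up (m := a + b + c + d - 2 * e) ns' ns);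
  [|ring|rewrite -Ea -Eb -Ec -Ed -Ee; ring].
rewrite (gshift_up (m := e - a + k) ma' ma); [|ring|rewrite -Ea -Ee -Ek; ring].
(* Brings the increments of the unmoved Gamma factors back to their old form, so that these factors
   become equal atoms on both sides. *)
have cancel (x z : int) : x + 1 - (z + 1) = x - z by ring.
have cancelr (x z t : int) : x + (z + 1) - (t + 1) = x + z - t by ring.
rewrite !cancel !cancelr.
rewrite (@exprN1S (a + b + c + d + e + 1 + 1 + 1)); last by ring.
rewrite !(exprN1S erefl) !opprK.
have -> : e0 + (e + 1)%:~R + 2 * (k0 + k%:~R) = e' + 1 + 2 * k' by rewrite -Ee -Ek; ring.
have -> : e0 + e%:~R + 2 * (k0 + k%:~R) = e' + 2 * k' by rewrite -Ee -Ek.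
rewrite /q; generalize_gshift.
move: (_ ^ _) => sg.
move: (nonint_neq0 nl) (nonint_neq0 nl') (nonint_neq0 ma').
move: (nonint_neq0 nbc') (nonint_neq0 nbd') (nonint_neq0 ncd').
by generalize_neq0; move=> *; field; do ?[apply/andP; split].
Qed.

(** Two identities combine: (kappa + gamma)(kappa + delta) - (2 kappa + 1)(gamma + delta - 1) =
    (kappa - gamma + 1)(kappa - delta + 1), and (kappa + alpha)(kappa + beta) - (kappa -
    alpha)(kappa - beta) = 2 kappa (alpha + beta). *)
Lemma cohomologous_step_abe k0 a0 b0 c0 d0 e0 k a b c d e (y := Vec k0 a0 b0 c0 d0 e0) :
  summation_point y -> nonint (a0 + b0 - e0) -> nonint (c0 + d0 - e0) ->
  cohomologous y (Vec k a b c d e) (Vec k (a + 1) (b + 1) c d (e + 1)).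
Proof.
move=> py nab ncd; have := summation_point_translate (Vec k a b c d e) py.
move E : (translate _ _) => y'; case: y' E => k' a' b' c' d' e' E py'.
pose R k' := - ((e' - a' + k') * (e' - b' + k')) / ((e' + 2 * k') * (a' + b' - e')).
pose q := - (e' + 1 + 2 * k') * ((a' + k') * (b' + k') * (c' + d' - e' - 1))
  / ((e' + 2 * k') * ((e' - c' + 1 + k') * (e' - d' + 1 + k')) * (a' + b' - e')).
case: E py' => Ek Ea Eb Ec Ed Ee.
have nab' : nonint (a' + b' - e').
  by apply: (nonint_addr (m := a + b - e) nab); rewrite -Ea -Eb -Ee; ring.
(* This step lowers x_cd, so the factor gained is x_cd - 1 and not x_cd. *)
have ncd' : nonint (c' + d' - e' - 1).
  by apply: (nonint_addr (m := c + d - e - 1) ncd); rewrite -Ec -Ed -Ee; ring.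
move=> [[sk sa sb [sc sd se]] nl' [na' nb' nc' nd'] [ma' mb' mc' md']].
apply: (@cohomologous_step y _ _ q (R k') py); last first.
  have -> : s (R k') = R (k' + 1).
    by rewrite /R !(rmorphM, fmorphV, rmorphN, rmorphD, rmorph_nat) sk sa sb se.
  rewrite /translate /y /= Ek Ea Eb Ec Ed Ee /R /q.
  move: (nonint_neq0 nl') (nl' 2) (nonint_neq0 ma') (nonint_neq0 mb') (nonint_neq0 mc').
  move: (nonint_neq0 md') (nonint_neq0 nab') => *.
  field; do ?[apply/andP; split] => //.
  by have -> : e' + 2 * (k' + 1) = e' + 2 * k' + 2 by ring.
move: py => [_ nl [na nb nc nd] [ma mb mc md]].
rewrite /= (gshift_up (m := a + k) na' na); [|ring|rewrite -Ea -Ek; ring].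
rewrite (gshift_up (m := b + k) nb' nb); [|ring|rewrite -Eb -Ek; ring].
rewrite (gshift_up (m := a + b - e) nab' nab); [|ring|rewrite -Ea -Eb -Ee; ring].
rewrite (gshift_down (m := c + d - e) ncd' ncd); [|ring|rewrite -Ec -Ed -Ee; ring].
rewrite (gshift_up (m := e - c + k) mc' mc); [|ring|rewrite -Ec -Ee -Ek; ring].
rewrite (gshift_up (m := e - d + k) md' md); [|ring|rewrite -Ed -Ee -Ek; ring].
have cancel (x z : int) : x + 1 - (z + 1) = x - z by ring.
have cancell (x z t : int) : x + 1 + z - (t + 1) = x + z - t by ring.
have -> : a + 1 + (b + 1) + c + d - 2 * (e + 1) = a + b + c + d - 2 * e by ring.
rewrite !cancel !cancell.
rewrite (@exprN1S (a + b + c + d + e + 1 + 1)); last by ring.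
rewrite !(exprN1S erefl) !opprK.
have -> : e0 + (e + 1)%:~R + 2 * (k0 + k%:~R) = e' + 1 + 2 * k' by rewrite -Ee -Ek; ring.
have -> : e0 + e%:~R + 2 * (k0 + k%:~R) = e' + 2 * k' by rewrite -Ee -Ek.
rewrite /q; generalize_gshift.
move: (_ ^ _) => sg.
move: (nonint_neq0 nl) (nonint_neq0 nl') (nonint_neq0 mc') (nonint_neq0 md').
move: (nonint_neq0 nab') (nonint_neq0 ncd').
by generalize_neq0; move=> *; field; do ?[apply/andP; split].
Qed.

(** * Iterated steps and their images under permutations *)

Lemma cohomologous_shift_k k0 a0 b0 c0 d0 e0 k a b c d e m (y := Vec k0 a0 b0 c0 d0 e0) :
  summation_point y -> cohomologous y (Vec k a b c d e) (Vec (k + m) a b c d e).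
Proof.
move=> py; rewrite -[k in X in cohomologous _ X _]addr0.
apply: (@cohomologous_iter y (fun m => Vec (k + m) a b c d e)) => {}m.
by rewrite addrA; apply: cohomologous_step_k.
Qed.

Lemma cohomologous_shift_a k0 a0 b0 c0 d0 e0 k a b c d e m (y := Vec k0 a0 b0 c0 d0 e0) :
  summation_point y ->
  nonint (a0 + b0 - e0) -> nonint (a0 + c0 - e0) -> nonint (a0 + d0 - e0) ->
  nonint (a0 + b0 + c0 + d0 - 2 * e0) ->
  cohomologous y (Vec k a b c d e) (Vec k (a + m) b c d e).
Proof.
move=> py nab nac nad ns; rewrite -[a in X in cohomologous _ X _]addr0.
apply: (@cohomologous_iter y (fun m => Vec k (a + m) b c d e)) => {}m.
by rewrite addrA; apply: cohomologous_step_a.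
Qed.

(** The shift of a is carried to b, then to c and to d, by successive transpositions. *)
Lemma cohomologous_shift_b k0 a0 b0 c0 d0 e0 k a b c d e m (y := Vec k0 a0 b0 c0 d0 e0) :
  summation_point y ->
  nonint (a0 + b0 - e0) -> nonint (b0 + c0 - e0) -> nonint (b0 + d0 - e0) ->
  nonint (a0 + b0 + c0 + d0 - 2 * e0) ->
  cohomologous y (Vec k a b c d e) (Vec k a (b + m) c d e).
Proof.
move=> py; rewrite (addrC a0 b0) => *.
apply: cohomologous_swap_ab; apply: cohomologous_shift_a => //.
exact: (summation_point_swap_ab py).
Qed.

Lemma cohomologous_shift_c k0 a0 b0 c0 d0 e0 k a b c d e m (y := Vec k0 a0 b0 c0 d0 e0) :
  summation_point y ->
  nonint (a0 + c0 - e0) -> nonint (b0 + c0 - e0) -> nonint (c0 + d0 - e0) ->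
  nonint (a0 + b0 + c0 + d0 - 2 * e0) ->
  cohomologous y (Vec k a b c d e) (Vec k a b (c + m) d e).
Proof.
move=> py; rewrite (addrAC a0 b0) (addrC b0 c0) => *; apply: cohomologous_swap_bc.
by apply: cohomologous_shift_b => //; exact: (summation_point_swap_bc py).
Qed.

Lemma cohomologous_shift_d k0 a0 b0 c0 d0 e0 k a b c d e m (y := Vec k0 a0 b0 c0 d0 e0) :
  summation_point y ->
  nonint (a0 + d0 - e0) -> nonint (b0 + d0 - e0) -> nonint (c0 + d0 - e0) ->
  nonint (a0 + b0 + c0 + d0 - 2 * e0) ->
  cohomologous y (Vec k a b c d e) (Vec k a b c (d + m) e).
Proof.
move=> py; rewrite (addrAC _ c0) (addrC c0 d0) => *; apply: cohomologous_swap_cd.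
by apply: cohomologous_shift_c => //; exact: (summation_point_swap_cd py).
Qed.

Lemma cohomologous_shift_bcde k0 a0 b0 c0 d0 e0 k a b c d e m (y := Vec k0 a0 b0 c0 d0 e0) :
  summation_point y ->
  nonint (b0 + c0 - e0) -> nonint (b0 + d0 - e0) -> nonint (c0 + d0 - e0) ->
  nonint (a0 + b0 + c0 + d0 - 2 * e0) ->
  cohomologous y (Vec k a b c d e) (Vec k a (b + m) (c + m) (d + m) (e + m)).
Proof.
move=> py nbc nbd ncd ns.
have := @cohomologous_iter y (fun m => Vec k a (b + m) (c + m) (d + m) (e + m)) _ m.
by rewrite !addr0; apply=> {}m; rewrite !addrA; apply: cohomologous_step_bcde.
Qed.

(** The index left fixed is carried from a to b, then to c and to d, by successive
    transpositions. *)
Lemma cohomologous_shift_acde k0 a0 b0 c0 d0 e0 k a b c d e m (y := Vec k0 a0 b0 c0 d0 e0) :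
  summation_point y ->
  nonint (a0 + c0 - e0) -> nonint (a0 + d0 - e0) -> nonint (c0 + d0 - e0) ->
  nonint (a0 + b0 + c0 + d0 - 2 * e0) ->
  cohomologous y (Vec k a b c d e) (Vec k (a + m) b (c + m) (d + m) (e + m)).
Proof.
move=> py; rewrite (addrC a0 b0) => *.
apply: cohomologous_swap_ab; apply: cohomologous_shift_bcde => //.
exact: (summation_point_swap_ab py).
Qed.

Lemma cohomologous_shift_abde k0 a0 b0 c0 d0 e0 k a b c d e m (y := Vec k0 a0 b0 c0 d0 e0) :
  summation_point y ->
  nonint (a0 + b0 - e0) -> nonint (a0 + d0 - e0) -> nonint (b0 + d0 - e0) ->
  nonint (a0 + b0 + c0 + d0 - 2 * e0) ->
  cohomologous y (Vec k a b c d e) (Vec k (a + m) (b + m) c (d + m) (e + m)).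
Proof.
move=> py nab nad nbd; rewrite (addrAC a0 b0) => *; apply: cohomologous_swap_bc.
by apply: cohomologous_shift_acde => //; exact: (summation_point_swap_bc py).
Qed.

Lemma cohomologous_shift_abce k0 a0 b0 c0 d0 e0 k a b c d e m (y := Vec k0 a0 b0 c0 d0 e0) :
  summation_point y ->
  nonint (a0 + b0 - e0) -> nonint (a0 + c0 - e0) -> nonint (b0 + c0 - e0) ->
  nonint (a0 + b0 + c0 + d0 - 2 * e0) ->
  cohomologous y (Vec k a b c d e) (Vec k (a + m) (b + m) (c + m) d (e + m)).
Proof.
move=> py nab nac nbc; rewrite (addrAC _ c0) => *; apply: cohomologous_swap_cd.
by apply: cohomologous_shift_abde => //; exact: (summation_point_swap_cd py).
Qed.

(** The hypothesis is conditional so that the shift by 0 remains available when x_ab or x_cd is an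
    integer constant. *)
Lemma cohomologous_shift_abe k0 a0 b0 c0 d0 e0 k a b c d e m (y := Vec k0 a0 b0 c0 d0 e0) :
  summation_point y ->
  (m != 0 -> nonint (a0 + b0 - e0) /\ nonint (c0 + d0 - e0)) ->
  cohomologous y (Vec k a b c d e) (Vec k (a + m) (b + m) c d (e + m)).
Proof.
move=> py; have [-> _|_ []// nab ncd] := eqVneq m 0.
  by rewrite !addr0; apply: cohomologous_refl.
have := @cohomologous_iter y (fun m => Vec k (a + m) (b + m) c d (e + m)) _ m.
by rewrite !addr0; apply=> {}m; rewrite !addrA; apply: cohomologous_step_abe.
Qed.

Lemma cohomologous_shift_ace k0 a0 b0 c0 d0 e0 k a b c d e m (y := Vec k0 a0 b0 c0 d0 e0) :
  summation_point y ->
  (m != 0 -> nonint (a0 + c0 - e0) /\ nonint (b0 + d0 - e0)) ->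
  cohomologous y (Vec k a b c d e) (Vec k (a + m) b (c + m) d (e + m)).
Proof.
move=> py ?; apply: cohomologous_swap_bc; apply: cohomologous_shift_abe => //.
exact: (summation_point_swap_bc py).
Qed.

Lemma cohomologous_shift_ade k0 a0 b0 c0 d0 e0 k a b c d e m (y := Vec k0 a0 b0 c0 d0 e0) :
  summation_point y ->
  (m != 0 -> nonint (a0 + d0 - e0) /\ nonint (b0 + c0 - e0)) ->
  cohomologous y (Vec k a b c d e) (Vec k (a + m) b c (d + m) (e + m)).
Proof.
move=> py ?; apply: cohomologous_swap_cd; apply: cohomologous_shift_ace => //.
exact: (summation_point_swap_cd py).
Qed.

(* Both shifts add m to k + e/2 and fix a - e/2, b - e/2, c - e/2, d - e/2. *)
Lemma quotient_abcdee y k a b c d e m :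
  quotient y (Vec k (a + m) (b + m) (c + m) (d + m) (e + 2 * m)) =
  quotient y (Vec (k + m) a b c d e).
Proof.
case: y => k0 a0 b0 c0 d0 e0 /=.
have -> : (-1) ^ (a + m + (b + m) + (c + m) + (d + m) + (e + 2 * m)) =
    (-1) ^ (a + b + c + d + e) :> K.
  have -> : a + m + (b + m) + (c + m) + (d + m) + (e + 2 * m) =
    a + b + c + d + e + 2 * (3 * m) by ring.
  have sq : (-1 : K) ^ (2 : int) = 1 by rewrite -[LHS]/((-1) ^+ 2) sqrrN expr1n.
  by rewrite exprzDr ?unitrN1 // -exprz_exp sq exp1rz mulr1.
have E1 x : x + m + k = x + (k + m) by ring.
have E2 x : e + 2 * m - (x + m) + k = e - x + (k + m) by ring.
have E3 x z : x + m + (z + m) - (e + 2 * m) = x + z - e by ring.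
have -> : a + m + (b + m) + (c + m) + (d + m) - 2 * (e + 2 * m) = a + b + c + d - 2 * e.
  by ring.
have -> : e0 + (e + 2 * m)%:~R + 2 * (k0 + k%:~R) = e0 + e%:~R + 2 * (k0 + (k + m)%:~R).
  by ring.
by rewrite !E1 !E2 !E3.
Qed.

(** * Paths that never move an integer constant form *)

Lemma cohomologous_balanced k0 a0 b0 c0 d0 e0 k a b c d e k' a' b' c' d' e'
    (y := Vec k0 a0 b0 c0 d0 e0) :
  summation_point y ->
  a' + b' + c' + d' - 2 * e' = a + b + c + d - 2 * e ->
  (a' + b' - e' != a + b - e -> nonint (a0 + b0 - e0) /\ nonint (c0 + d0 - e0)) ->
  (a' + c' - e' != a + c - e -> nonint (a0 + c0 - e0) /\ nonint (b0 + d0 - e0)) ->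
  (a' + d' - e' != a + d - e -> nonint (a0 + d0 - e0) /\ nonint (b0 + c0 - e0)) ->
  cohomologous y (Vec k a b c d e) (Vec k' a' b' c' d' e').
Proof.
move=> py bal hb hc hd.
(* The step (a,b,e) changes x_ab by 1, x_cd by -1 and no other form x_ij. As s is already in place,
   adjusting x_ab therefore adjusts x_cd too; likewise for the other two pairs. *)
set mb := a' + b' - e' - (a + b - e); set mc := a' + c' - e' - (a + c - e).
set md := a' + d' - e' - (a + d - e).
apply: cohomologous_trans (cohomologous_shift_abe (m := mb) _ _ _ _ _ _ py _) _.
  by rewrite subr_eq0.
apply: cohomologous_trans (cohomologous_shift_ace (m := mc) _ _ _ _ _ _ py _) _.
  by rewrite subr_eq0.
apply: cohomologous_trans (cohomologous_shift_ade (m := md) _ _ _ _ _ _ py _) _.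
  by rewrite subr_eq0.
(* With all x_ij in place, the increment still missing is t in each of a, b, c, d and 2t in e. The
   three shifts above preserve e - a, so t = 2t - t is read off from e - a. This increment is traded
   for t in k. *)
set t := e' - e - (a' - a).
apply: cohomologous_trans (cohomologous_shift_k _ _ _ _ _ _ (k' + t - k) py) _.
rewrite addrC subrK.
exists 0; rewrite rmorph0 mul0r subrr -quotient_abcdee; apply/eqP; rewrite subr_eq0; apply/eqP.
by congr (quotient y (Vec _ _ _ _ _ _)); rewrite /t /mb /mc /md; lia.
Qed.

Ltac solve_nonint :=
  by first [assumption
    | match goal with H : _ -> nonint ?x |- nonint ?x => apply: H; lia end].

Lemma cohomologous_path k0 a0 b0 c0 d0 e0 k' a' b' c' d' e'
    (y := Vec k0 a0 b0 c0 d0 e0) :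
  summation_point y ->
  (a' + b' + c' + d' - 2 * e' != 0 -> nonint (a0 + b0 + c0 + d0 - 2 * e0)) ->
  (a' + b' - e' != 0 -> nonint (a0 + b0 - e0)) ->
  (a' + c' - e' != 0 -> nonint (a0 + c0 - e0)) ->
  (a' + d' - e' != 0 -> nonint (a0 + d0 - e0)) ->
  (b' + c' - e' != 0 -> nonint (b0 + c0 - e0)) ->
  (b' + d' - e' != 0 -> nonint (b0 + d0 - e0)) ->
  (c' + d' - e' != 0 -> nonint (c0 + d0 - e0)) ->
  cohomologous y (Vec 0 0 0 0 0 0) (Vec k' a' b' c' d' e').
Proof.
move=> py hs hab hac had hbc hbd hcd.
have [m0|/[dup] mn0 /hs ns] := eqVneq (a' + b' + c' + d' - 2 * e') 0.
  by apply: cohomologous_balanced => // ?; split; solve_nonint.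
set m := a' + b' + c' + d' - 2 * e'.
(* Take x_ab, x_ac, x_ad where they move and the opposite form otherwise. The three chosen forms
   either share one index, which is then the one to shift, or involve three indices, which are
   shifted together with e. *)
have [ab0|ab0] := eqVneq (a' + b' - e') 0;
have [ac0|ac0] := eqVneq (a' + c' - e') 0;
have [ad0|ad0] := eqVneq (a' + d' - e') 0.
- have nbc : nonint (b0 + c0 - e0) by apply: hbc; lia.
  have nbd : nonint (b0 + d0 - e0) by apply: hbd; lia.
  have ncd : nonint (c0 + d0 - e0) by apply: hcd; lia.
  apply: cohomologous_trans (cohomologous_shift_bcde _ _ _ _ _ _ m py nbc nbd ncd ns) _.
  by apply: cohomologous_balanced => //; rewrite /m; [lia|..];
    move=> ?; first [lia | split; solve_nonint].
- have nad : nonint (a0 + d0 - e0) by apply: had; lia.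
  have nbd : nonint (b0 + d0 - e0) by apply: hbd; lia.
  have ncd : nonint (c0 + d0 - e0) by apply: hcd; lia.
  apply: cohomologous_trans (cohomologous_shift_d _ _ _ _ _ _ m py nad nbd ncd ns) _.
  (* The chosen form of each pair has now moved by m and the other by 0. If a pair is still off
     target, its chosen form must move by some X different from 0 and m; then the other must move by
     m - X, also nonzero, so both are [nonint]. *)
  by apply: cohomologous_balanced => //; rewrite /m; [lia|..];
    move=> ?; first [lia | split; solve_nonint].
- have nac : nonint (a0 + c0 - e0) by apply: hac; lia.
  have nbc : nonint (b0 + c0 - e0) by apply: hbc; lia.
  have ncd : nonint (c0 + d0 - e0) by apply: hcd; lia.
  apply: cohomologous_trans (cohomologous_shift_c _ _ _ _ _ _ m py nac nbc ncd ns) _.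
  by apply: cohomologous_balanced => //; rewrite /m; [lia|..];
    move=> ?; first [lia | split; solve_nonint].
- have nac : nonint (a0 + c0 - e0) by apply: hac; lia.
  have nad : nonint (a0 + d0 - e0) by apply: had; lia.
  have ncd : nonint (c0 + d0 - e0) by apply: hcd; lia.
  apply: cohomologous_trans (cohomologous_shift_acde _ _ _ _ _ _ m py nac nad ncd ns) _.
  by apply: cohomologous_balanced => //; rewrite /m; [lia|..];
    move=> ?; first [lia | split; solve_nonint].
- have nab : nonint (a0 + b0 - e0) by apply: hab; lia.
  have nbc : nonint (b0 + c0 - e0) by apply: hbc; lia.
  have nbd : nonint (b0 + d0 - e0) by apply: hbd; lia.
  apply: cohomologous_trans (cohomologous_shift_b _ _ _ _ _ _ m py nab nbc nbd ns) _.
  by apply: cohomologous_balanced => //; rewrite /m; [lia|..];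
    move=> ?; first [lia | split; solve_nonint].
- have nab : nonint (a0 + b0 - e0) by apply: hab; lia.
  have nad : nonint (a0 + d0 - e0) by apply: had; lia.
  have nbd : nonint (b0 + d0 - e0) by apply: hbd; lia.
  apply: cohomologous_trans (cohomologous_shift_abde _ _ _ _ _ _ m py nab nad nbd ns) _.
  by apply: cohomologous_balanced => //; rewrite /m; [lia|..];
    move=> ?; first [lia | split; solve_nonint].
- have nab : nonint (a0 + b0 - e0) by apply: hab; lia.
  have nac : nonint (a0 + c0 - e0) by apply: hac; lia.
  have nbc : nonint (b0 + c0 - e0) by apply: hbc; lia.
  apply: cohomologous_trans (cohomologous_shift_abce _ _ _ _ _ _ m py nab nac nbc ns) _.
  by apply: cohomologous_balanced => //; rewrite /m; [lia|..];
    move=> ?; first [lia | split; solve_nonint].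
- have nab : nonint (a0 + b0 - e0) by apply: hab; lia.
  have nac : nonint (a0 + c0 - e0) by apply: hac; lia.
  have nad : nonint (a0 + d0 - e0) by apply: had; lia.
  apply: cohomologous_trans (cohomologous_shift_a _ _ _ _ _ _ m py nab nac nad ns) _.
  by apply: cohomologous_balanced => //; rewrite /m; [lia|..];
    move=> ?; first [lia | split; solve_nonint].
Qed.

End Seed.

(** * Extension of an injective ring morphism to the fraction field *)

Section FractionExtension.
Variables (R : idomainType) (F : fieldType) (g : {rmorphism R -> F}).
Hypothesis g_inj : injective g.
Notation tofrac := (@FracField.tofrac R).

Lemma fraction_divE (x : {fraction R}) :
  exists p q : R, q != 0 /\ x = tofrac p / tofrac q.
Proof.
elim/quotW: x => x; exists \n_x, \d_x; have dx : \d_x != 0 := denom_ratioP x.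
split=> //; have dx' : tofrac \d_x != 0 by rewrite tofrac_eq0.
apply: (mulIf dx'); rewrite mulfVK //; unlock FracField.tofrac.
rewrite -[LHS]FracField.pi_mul; apply/eqmodP.
rewrite /= FracField.equivfE /FracField.mulf !numden_Ratio ?mulr1 ?oner_neq0 //.
by rewrite mulrC.
Qed.

(** Defined on the canonical representative; [fraction_ext_div] shows that any other representative
    gives the same value. *)
Definition fraction_ext (x : {fraction R}) : F := g \n_(repr x) / g \d_(repr x).

Lemma fraction_ext_div p q : q != 0 ->
  fraction_ext (tofrac p / tofrac q) = g p / g q.
Proof.
have gz z : z != 0 -> g z != 0 by rewrite -(rmorph0 g) (inj_eq g_inj).
move=> q0; rewrite /fraction_ext; set x := repr _.
have dx : \d_x != 0 := denom_ratioP x.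
have dx' : tofrac \d_x != 0 by rewrite tofrac_eq0.
have q0' : tofrac q != 0 by rewrite tofrac_eq0.
apply/eqP; rewrite eqr_div ?gz // -!rmorphM (inj_eq g_inj) -tofrac_eq !tofracM.
rewrite -eqr_div //; apply/eqP; rewrite -[RHS]reprK -/x.
apply: (mulIf dx'); rewrite mulfVK //; unlock FracField.tofrac.
rewrite -[RHS]FracField.pi_mul; apply/eqmodP.
(* Equality of classes is now cross-multiplication of numerators and denominators. *)
rewrite /= FracField.equivfE /FracField.mulf !numden_Ratio ?mulr1 ?oner_neq0 //.
by rewrite mul1r mulrC.
Qed.

Lemma fraction_ext_is_zmod_morphism : zmod_morphism fraction_ext.
Proof.
have gz z : z != 0 -> g z != 0 by rewrite -(rmorph0 g) (inj_eq g_inj).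
move=> x y; have [p [q [q0 ->]]] := fraction_divE x.
have [p' [q' [q0' ->]]] := fraction_divE y.
rewrite -mulNr addf_div ?tofrac_eq0 // -tofracN -!tofracM -tofracD.
rewrite !fraction_ext_div ?mulf_neq0 // -mulNr addf_div ?gz //.
by rewrite rmorphD !rmorphM rmorphN.
Qed.

Lemma fraction_ext_is_monoid_morphism : monoid_morphism fraction_ext.
Proof.
split=> [|x y].
  by rewrite -[1]divr1 -tofrac1 fraction_ext_div ?oner_neq0 // rmorph1 divr1.
have [p [q [q0 ->]]] := fraction_divE x; have [p' [q' [q0' ->]]] := fraction_divE y.
rewrite mulf_div -!tofracM !fraction_ext_div ?mulf_neq0 //.
by rewrite !rmorphM mulf_div.
Qed.

HB.instance Definition _ := GRing.isZmodMorphism.Build {fraction R} F fraction_ext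
  fraction_ext_is_zmod_morphism.
HB.instance Definition _ := GRing.isMonoidMorphism.Build {fraction R} F fraction_ext
  fraction_ext_is_monoid_morphism.

Lemma fraction_extension : exists f : {rmorphism {fraction R} -> F},
  forall p q, q != 0 -> f (tofrac p / tofrac q) = g p / g q.
Proof. by exists fraction_ext; exact: fraction_ext_div. Qed.

End FractionExtension.

(** * The field of rational functions in n and k, and linear forms in it *)

Section Model.
Variable C : numClosedFieldType.
Implicit Types (L M : linform C) (p q : P2 C).

(** Composition with a nonconstant polynomial has trivial kernel. Injectivity is what lets the shift
    extend to [RF C]. *)
Lemma shift_k_inj : injective (@shift_k C).
Proof.
move=> p q; rewrite /shift_k => /eqP; rewrite -subr_eq0 -rmorphB /= comp_poly2_eq0.
  by rewrite subr_eq0 => /eqP.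
by rewrite size_XaddC.
Qed.

Lemma shift_k_fraction : exists s : {rmorphism RF C -> RF C},
  forall p q, q != 0 -> s (rf p / rf q) = rf (shift_k p) / rf (shift_k q).
Proof.
pose g : {rmorphism P2 C -> RF C} := (@FracField.tofrac (P2 C)) \o (comp_poly ('X + 1)).
have [|s Es] := @fraction_extension _ _ g; last by exists s.
move=> p q /eqP; rewrite /g /= tofrac_eq => /eqP; exact: shift_k_inj.
Qed.

Lemma linP_addL L M : linP (addL L M) = linP L + linP M.
Proof. rewrite /linP /= /cst !mulrzDr !polyCD; ring. Qed.

Lemma linP_subL L M : linP (subL L M) = linP L - linP M.
Proof. rewrite /linP /= /cst !mulrzBr !polyCB; ring. Qed.

Lemma linP_scaleL z L : linP (scaleL z L) = z%:~R * linP L.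
Proof.
have cstMz (c : C) : cst (c *~ z) = cst c *~ z by rewrite /cst !raddfMz.
by rewrite mulrzl /linP /= cstMz 2!(mulrC z) !mulrzA !mulrzDl.
Qed.

Lemma linP_cstL1 : linP (cstL (1 : C)) = 1.
Proof. by rewrite /linP /= !mulr0z !add0r. Qed.

Lemma linP_shiftL_n L : linP (shiftL_n L) = linP L + (lin_n L)%:~R.
Proof. by rewrite /linP /= /cst !rmorphD /= !rmorph_int addrA. Qed.

Lemma linP_shiftL_k L : linP (shiftL_k L) = linP L + (lin_k L)%:~R.
Proof. by rewrite /linP /= /cst !rmorphD /= !rmorph_int addrA. Qed.

Lemma linP_neq0 L : (lin_n L != 0) || (lin_k L != 0) -> linP L != 0.
Proof.
move=> nz; apply/eqP => E; move: nz; apply/negP; rewrite negb_or !negbK.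
(* These two coefficients are those of n and of k; integers embed in [C] because the characteristic
   is 0. *)
have := congr1 (fun p : P2 C => p`_0`_1) E.
have := congr1 (fun p : P2 C => p`_1`_0) E.
rewrite /linP /cst /var_n /var_k !coefD !coefMrz !(coefC, coefX) /=.
rewrite !mul0rz add0r !addr0 => /eqP; rewrite intr_eq0 => /eqP -> /eqP.
by rewrite intr_eq0 eqxx andbT.
Qed.

Lemma rf_linP_nonint L : (lin_n L != 0) || (lin_k L != 0) -> nonint (rf (linP L)).
Proof.
move=> nz j; have -> : rf (linP L) + j%:~R = rf (linP (Lin (lin_n L) (lin_k L) (lin_c L + j%:~R))).
  rewrite -(rmorph_int (@FracField.tofrac (P2 C))) -tofracD; congr rf.
  by rewrite /linP /= /cst !rmorphD /= !rmorph_int addrA.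
by rewrite tofrac_eq0 linP_neq0.
Qed.

Lemma shift_k_linP L : shift_k (linP L) = linP L + (lin_k L)%:~R.
Proof.
rewrite /shift_k /linP /cst !rmorphD /= !raddfMz /= !comp_polyC comp_polyX mulrzDl.
by rewrite addrA [RHS]addrAC.
Qed.

Lemma gamma_shiftE (p : P2 C) m : gamma_shift p m = gshift (rf p) m.
Proof.
case: m => j; rewrite /gamma_shift /gshift; last congr (_^-1);
  by apply: eq_bigr => i _; rewrite /rf ?tofracB ?tofracD rmorph_nat.
Qed.

(** Common form of [ratio_n] and [ratio_k]: [v] evaluates a form and [l] selects its increment. *)
Definition shift_quotient (F : fieldType) (v : linform C -> F) (l : linform C -> int)
    (T : cterm C) : F :=
  (-1) ^ l (ct_sign T) * \prod_(L <- ct_lin T) ((v L + (l L)%:~R) / v L)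
  * \prod_(L <- ct_num T) gshift (v L) (l L) / \prod_(L <- ct_den T) gshift (v L) (l L).

Lemma ratio_nE T : ratio_n T = shift_quotient (fun L => rf (linP L)) (@lin_n C) T.
Proof.
rewrite /ratio_n /shift_quotient; congr (_ * _ * _ / _); apply: eq_bigr => L _;
  by rewrite ?gamma_shiftE // linP_shiftL_n /rf tofracD rmorph_int.
Qed.

Lemma ratio_kE T : ratio_k T = shift_quotient (fun L => rf (linP L)) (@lin_k C) T.
Proof.
rewrite /ratio_k /shift_quotient; congr (_ * _ * _ / _); apply: eq_bigr => L _;
  by rewrite ?gamma_shiftE // linP_shiftL_k /rf tofracD rmorph_int.
Qed.

(** The value [c] at the constant form 1 is 1 for an evaluation and 0 for a coefficient of n or
    k. *)
Definition additive_on_forms (A : pzRingType) (v : linform C -> A) (c : A) : Prop :=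
  [/\ forall L M, v (addL L M) = v L + v M, forall L M, v (subL L M) = v L - v M,
      forall L, v (scaleL 2 L) = 2 * v L & v (cstL 1) = c].

Lemma rf_linP_additive : additive_on_forms (fun L => rf (linP L)) 1.
Proof.
split=> [L M|L M|L|]; rewrite /rf.
- by rewrite linP_addL tofracD.
- by rewrite linP_subL tofracB.
- by rewrite linP_scaleL tofracM rmorph_int.
- by rewrite linP_cstL1 tofrac1.
Qed.

Lemma lin_n_additive : additive_on_forms (@lin_n C) 0. Proof. by []. Qed.

Lemma lin_k_additive : additive_on_forms (@lin_k C) 0. Proof. by []. Qed.

Lemma shift_quotient_F0 (F : fieldType) (v : linform C -> F) (l : linform C -> int)
    (k a b c d e : linform C) :
  additive_on_forms v 1 -> additive_on_forms l 0 ->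
  shift_quotient v l (F0_term k a b c d e) =
  quotient (Vec (v k) (v a) (v b) (v c) (v d) (v e)) (Vec (l k) (l a) (l b) (l c) (l d) (l e)).
Proof.
move=> [vD vB v2 v1] [lD lB l2 l1].
rewrite /shift_quotient /F0_term /= !big_cons !big_nil.
rewrite !(vD, vB, v2, v1) !(lD, lB, l2, l1) !addr0 !mulr1 !mulrA.
have -> : v e + (l e)%:~R + 2 * (v k + (l k)%:~R) = v e + 2 * v k + (l e + 2 * l k)%:~R.
  by ring.
by rewrite ?mulrA.
Qed.

End Model.

(** * The mate equation for the substituted F0 *)

Lemma quotient0 (K : fieldType) (y : vec K) : ve y + 2 * vk y != 0 ->
  quotient y (Vec 0 0 0 0 0 0) = 1.
Proof.
case: y => k a b c d e /= nz.
suff E z : z = 0 -> quotient (Vec k a b c d e) (Vec z z z z z z) = 1 by exact: E.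
move=> z0; rewrite /quotient z0 !(mulr0, addr0, subr0) !gshift0 expr0z divff //.
by rewrite !mulr1 divr1.
Qed.

Lemma quotient_k (K : fieldType) (y : vec K) : quotient y (Vec 1 0 0 0 0 0) = kquotient y.
Proof.
case: y => k a b c d e; set y := Vec _ _ _ _ _ _.
suff E u z : u = 1 -> z = 0 -> quotient y (Vec u z z z z z) = kquotient y by exact: E.
move=> u1 z0; rewrite /y /quotient /kquotient u1 z0.
rewrite !(addr0, add0r, subr0, mulr0) !gshift0 !gshift1 expr0z !mulr1 mul1r.
by have -> : e + 2 * (k + 1) = e + 2 * k + 2 by ring.
Qed.

(** Advancing n by 1 translates the point by (K,A,B,Cc,D,E), and advancing k by 1 translates it by
    (1,0,0,0,0,0). The mate equation divided by F is thus a cohomology between 0 and the first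
    vector. *)
Lemma F0_subst_mate (C : numClosedFieldType) (F : fieldType) (s : {rmorphism F -> F})
    (v : linform C -> F) (K A B Cc D E : int) (k0 a b c d e : C) :
  additive_on_forms v 1 ->
  (forall L, (lin_n L != 0) || (lin_k L != 0) -> nonint (v L)) ->
  (forall L, s (v L) = v L + (lin_k L)%:~R) ->
  let F0 := F0_subst K A B Cc D E k0 a b c d e in
  exists R, shift_quotient v (@lin_n C) F0 - 1 = s R * shift_quotient v (@lin_k C) F0 - R.
Proof.
move=> vadd vn sv F0; have [vD vB v2 v1] := vadd; rewrite {}/F0 /F0_subst.
set Lk := Lin K 1 k0; set La := Lin A 0 a; set Lb := Lin B 0 b.
set Lc := Lin Cc 0 c; set Ld := Lin D 0 d; set Le := Lin E 0 e.
pose y := Vec (v Lk) (v La) (v Lb) (v Lc) (v Ld) (v Le).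
have vk L : lin_k L != 0 -> nonint (v L) by move=> nz; apply: vn; rewrite nz orbT.
have num (L : linform C) : lin_k L = 0 -> nonint (v L + v Lk).
  by move=> L0; rewrite -vD; apply: vk; rewrite /= L0.
have den (L : linform C) : lin_k L = 0 -> nonint (v Le - v L + 1 + v Lk).
  by move=> L0; rewrite -vB -v1 -!vD; apply: vk; rewrite /= L0.
have py : summation_point s y.
  split; first by rewrite !sv !addr0.
  - by rewrite -v2 -vD; apply: vk.
  - by split; apply: num.
  - by split; apply: den.
(* The increment of such a form is its coefficient of n; if this is nonzero, the form is not
   constant, hence never an integer. *)
have pair (L M N : linform C) : lin_n L + lin_n M - lin_n N != 0 ->
    nonint (v L + v M - v N).
  by move=> nz; rewrite -vD -vB; apply: vn; rewrite nz.
have [R ER] : cohomologous s y (Vec 0 0 0 0 0 0) (Vec K A B Cc D E).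
  have ns : A + B + Cc + D - 2 * E != 0 -> nonint (v La + v Lb + v Lc + v Ld - 2 * v Le).
    by move=> nz; rewrite -v2 -!vD -vB; apply: vn; rewrite nz.
  exact: cohomologous_path py ns (pair La Lb Le) (pair La Lc Le) (pair La Ld Le)
    (pair Lb Lc Le) (pair Lb Ld Le) (pair Lc Ld Le).
exists R; rewrite (shift_quotient_F0 _ _ _ _ _ _ vadd (lin_n_additive C)).
rewrite (shift_quotient_F0 _ _ _ _ _ _ vadd (lin_k_additive C)).
move: ER; rewrite quotient0 => [->|]; first by rewrite -quotient_k.
by case: py => _ /nonint_neq0.
Qed.

(* F0 is a WZ seed in the variables a,b,c,d,e. *)
Theorem theorem1 (C : numClosedFieldType) :
  forall (K A B Cc D E : int) (k0 a b c d e : C),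
    has_WZ_mate (F0_subst K A B Cc D E k0 a b c d e).
Proof.
move=> K A B Cc D E k0 a b c d e; have [s Es] := shift_k_fraction C.
have s_lin (L : linform C) : s (rf (linP L)) = rf (linP L) + (lin_k L)%:~R.
  have := Es (linP L) 1 (oner_neq0 _).
  rewrite {2}/shift_k rmorph1 /rf tofrac1 !divr1 => ->.
  by rewrite shift_k_linP tofracD rmorph_int.
have [R ER] := F0_subst_mate K A B Cc D E k0 a b c d e (rf_linP_additive C)
  (@rf_linP_nonint C) s_lin.
have [p [q [q0 RE]]] := fraction_divE R.
exists p, q; split=> //.
by rewrite ratio_nE ratio_kE ER RE Es.
Qed.
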